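(* Let $A$ be a pseudo-hoop and $\mu:A\to A$ a map. Then $\mu$ is a compatible type II state operator on $A$ if and only if $\mu$ is a compatible type I state operator on $A$ and ${\rm Ker}(\mu)=\{x\in A\mid\mu(x)=1\}$ is a fantastic filter of $A$.
   Context: A pseudo-hoop is an algebra $(A,\odot,\rightarrow,\rightsquigarrow,1)$ of type $(2,2,2,0)$ such that for all $x,y,z\in A$: $x\odot 1=1\odot x=x$; $x\rightarrow x=x\rightsquigarrow x=1$; $(x\odot y)\rightarrow z=x\rightarrow(y\rightarrow z)$; $(x\odot y)\rightsquigarrow z=y\rightsquigarrow(x\rightsquigarrow z)$; $(x\rightarrow y)\odot x=(y\rightarrow x)\odot y=x\odot(x\rightsquigarrow y)=y\odot(y\rightsquigarrow x)$. The order is $x\le y$ iff $x\rightarrow y=1$. Put $x\vee_1 y=(x\rightarrow y)\rightsquigarrow y$, $x\vee_2 y=(x\rightsquigarrow y)\rightarrow y$. For $\mu:A\to A$ and all $x,y$ consider: (IS1) $\mu(x\rightarrow y)=\mu(x\vee_1 y)\rightarrow\mu(y)$ and $\mu(x\rightsquigarrow y)=\mu(x\vee_2 y)\rightsquigarrow\mu(y)$; (IS1') $\mu(x\rightarrow y)=\mu(y\vee_1 x)\rightarrow\mu(y)$ and $\mu(x\rightsquigarrow y)=\mu(y\vee_2 x)\rightsquigarrow\mu(y)$; (IS2) $\mu(x\odot y)=\mu(x)\odot\mu(x\rightsquigarrow x\odot y)=\mu(y\rightarrow x\odot y)\odot\mu(y)$; (IS3) $\mu(\mu(x)\odot\mu(y))=\mu(x)\odot\mu(y)$;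 (IS4) $\mu(\mu(x)\rightarrow\mu(y))=\mu(x)\rightarrow\mu(y)$ and $\mu(\mu(x)\rightsquigarrow\mu(y))=\mu(x)\rightsquigarrow\mu(y)$. Type I: (IS1),(IS2),(IS3),(IS4); type II: (IS1'),(IS2),(IS3),(IS4). A filter is a nonempty $F\subseteq A$ closed under $\odot$ and upward closed; it is normal if for all $x,y$: $x\rightarrow y\in F$ iff $x\rightsquigarrow y\in F$; it is fantastic if for all $x,y$: $y\rightarrow x\in F$ implies $x\vee_1 y\rightarrow x\in F$, and $y\rightsquigarrow x\in F$ implies $x\vee_2 y\rightsquigarrow x\in F$. A state operator is compatible if its kernel is a normal filter. *)

(* Defs.v *)
From HB Require Import structures.
From mathcomp Require Import all_boot.
From mathcomp Require Import boolp classical_sets.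

Set Implicit Arguments.
Unset Strict Implicit.
Unset Printing Implicit Defensive.

Local Open Scope classical_set_scope.

Declare Scope hoop_scope.
Delimit Scope hoop_scope with hoop.
Local Open Scope hoop_scope.

HB.mixin Record isPseudoHoop (A : Type) := {
  hmul : A -> A -> A;
  himp : A -> A -> A;
  hsimp : A -> A -> A;
  hone : A;
  hmulx1 : forall x, hmul x hone = x;
  hmul1x : forall x, hmul hone x = x;
  himpxx : forall x, himp x x = hone;
  hsimpxx : forall x, hsimp x x = hone;
  himp_mul : forall x y z, himp (hmul x y) z = himp x (himp y z);
  hsimp_mul : forall x y z, hsimp (hmul x y) z = hsimp y (hsimp x z);
  (* The divisibility axiom is a chain of four equal terms, split into three equations. *)
  himp_div : forall x y, hmul (himp x y) x = hmul (himp y x) y;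
  himp_hsimp_div : forall x y, hmul (himp y x) y = hmul x (hsimp x y);
  hsimp_div : forall x y, hmul x (hsimp x y) = hmul y (hsimp y x)
}.

#[short(type="pseudoHoopType")]
HB.structure Definition PseudoHoop := { A of isPseudoHoop A }.

Notation "x ⊙ y" := (hmul x y) (at level 40, left associativity) : hoop_scope.
(* ⇒ is the residual → of the literature, since → is the Rocq function arrow *)
Notation "x ⇒ y" := (himp x y) (at level 55, no associativity) : hoop_scope.
Notation "x ⇝ y" := (hsimp x y) (at level 55, no associativity) : hoop_scope.
Notation "1" := hone : hoop_scope.

Section PseudoHoopNotions.
Variable A : pseudoHoopType.
Implicit Types (x y : A) (F : set A) (mu : A -> A).

Definition hle x y : Prop := x ⇒ y = 1.

Definition hvee1 x y : A := (x ⇒ y) ⇝ y.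
Definition hvee2 x y : A := (x ⇝ y) ⇒ y.

Definition hfilter F : Prop :=
  [/\ F !=set0,
      forall x y, F x -> F y -> F (x ⊙ y)
    & forall x y, F x -> hle x y -> F y].

Definition normal_filter F : Prop :=
  hfilter F /\ forall x y, F (x ⇒ y) <-> F (x ⇝ y).

Definition fantastic_filter F : Prop :=
  [/\ hfilter F,
      forall x y, F (y ⇒ x) -> F (hvee1 x y ⇒ x)
    & forall x y, F (y ⇝ x) -> F (hvee2 x y ⇝ x)].

Definition IS1 mu : Prop := forall x y,
  mu (x ⇒ y) = (mu (hvee1 x y) ⇒ mu y) /\
  mu (x ⇝ y) = (mu (hvee2 x y) ⇝ mu y).

Definition IS1' mu : Prop := forall x y,
  mu (x ⇒ y) = (mu (hvee1 y x) ⇒ mu y) /\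
  mu (x ⇝ y) = (mu (hvee2 y x) ⇝ mu y).

Definition IS2 mu : Prop := forall x y,
  mu (x ⊙ y) = mu x ⊙ mu (x ⇝ x ⊙ y) /\
  mu (x ⊙ y) = mu (y ⇒ x ⊙ y) ⊙ mu y.

Definition IS3 mu : Prop := forall x y,
  mu (mu x ⊙ mu y) = mu x ⊙ mu y.

Definition IS4 mu : Prop := forall x y,
  mu (mu x ⇒ mu y) = (mu x ⇒ mu y) /\
  mu (mu x ⇝ mu y) = (mu x ⇝ mu y).

Definition state_operator_I mu : Prop := [/\ IS1 mu, IS2 mu, IS3 mu & IS4 mu].

Definition state_operator_II mu : Prop :=
  [/\ IS1' mu, IS2 mu, IS3 mu & IS4 mu].

Definition Ker mu : set A := [set x | mu x = 1].

Definition compatible mu : Prop := normal_filter (Ker mu).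

End PseudoHoopNotions.

(* Main.v *)
(** Since [x ∨₁ y → y = x → y] and [y ≤ x ∨₁ y], (IS1') makes [mu] commute with
    [a → b] for [b ≤ a], which gives both (IS1) and
    [mu (x ∨₁ y → x) = mu (y → x)], hence a fantastic kernel. Conversely, under
    (IS1) the inclusion [u → v ∈ Ker mu] forces [mu u ≤ mu v], and a fantastic
    kernel contains [x ∨₁ y → y ∨₁ x], so [mu (x ∨₁ y) = mu (y ∨₁ x)] and (IS1)
    coincides with (IS1'). The statements about [⇝] are those about [→] in the
    opposite pseudo-hoop. *)

Require Import Defs.
From HB Require Import structures.
From mathcomp Require Import all_boot.
From mathcomp Require Import boolp classical_sets.

Set Implicit Arguments.
Unset Strict Implicit.
Unset Printing Implicit Defensive.

Local Open Scope hoop_scope.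

(** An alias, so that the reversed product and swapped residuals do not clash with the structure
    already on [A]. *)
Definition opposite (A : Type) : Type := A.

HB.instance Definition _ (A : pseudoHoopType) :=
  @isPseudoHoop.Build (opposite A) (fun x y : A => y ⊙ x)
    (@hsimp A) (@himp A) (@hone A) (@hmul1x A) (@hmulx1 A)
    (@hsimpxx A) (@himpxx A) (fun x y z => hsimp_mul y x z)
    (fun x y z => himp_mul y x z) (@hsimp_div A)
    (fun x y => esym (etrans (himp_div x y) (etrans (himp_hsimp_div x y)
                                                    (hsimp_div x y))))
    (@himp_div A).

Section Order.
Context {A : pseudoHoopType}.
Implicit Types x y z : A.

Lemma hle_anti x y : hle x y -> hle y x -> x = y.
Proof. by move=> xy yx; have := himp_div x y; rewrite xy yx !hmul1x. Qed.

(* Associativity of [⊙] is not an axiom, so [1 ⇒ x = x] is obtained by first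
   showing that elements fixed by [himp 1], such as [x ⇒ 1], lie below [1]. *)
Lemma himp1_fixed_le1 z : 1 ⇒ z = z -> z ⇒ 1 = 1.
Proof.
move=> fz; have zE : (z ⇒ 1) ⊙ z = z by rewrite himp_div fz hmulx1.
by rewrite -{1}zE himp_mul himpxx.
Qed.

Lemma himp1x x : 1 ⇒ x = x.
Proof.
have x_le : x ⇒ (1 ⇒ x) = 1 by rewrite -himp_mul hmulx1 himpxx.
have le_x : (1 ⇒ x) ⇒ x = 1.
  (* Divisibility turns [(1 ⇒ x) ⊙ 1] into [(x ⇒ 1) ⊙ x]. *)
  have -> : (1 ⇒ x) ⇒ x = (x ⇒ 1) ⇒ 1.
    by rewrite -{1}(hmulx1 (1 ⇒ x)) himp_div himp_mul himpxx.
  by apply: himp1_fixed_le1; rewrite -himp_mul hmul1x.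
exact: hle_anti.
Qed.

Lemma himpx1 x : x ⇒ 1 = 1.
Proof. exact/himp1_fixed_le1/himp1x. Qed.
End Order.

Lemma hsimp1x (A : pseudoHoopType) (x : A) : 1 ⇝ x = x.
Proof. exact: (@himp1x (opposite A)). Qed.

Lemma hsimpx1 (A : pseudoHoopType) (x : A) : x ⇝ 1 = 1.
Proof. exact: (@himpx1 (opposite A)). Qed.

(** Divisibility factors [x] as [y ⊙ (y ⇝ x)], and such a product lies below [y] for [⇝]. Hence both
    residuals define the same order. *)
Lemma hsimp_eq1 (A : pseudoHoopType) (x y : A) : x ⇒ y = 1 -> x ⇝ y = 1.
Proof.
move=> xy; have <- : y ⊙ (y ⇝ x) = x.
  by rewrite -himp_hsimp_div xy hmul1x.
by rewrite hsimp_mul hsimpxx hsimpx1.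
Qed.

Lemma hleEsimp (A : pseudoHoopType) (x y : A) : hle x y <-> x ⇝ y = 1.
Proof. by split; [exact: hsimp_eq1 | exact: (@hsimp_eq1 (opposite A))]. Qed.

Section Residuation.
Context {A : pseudoHoopType}.
Implicit Types x y z : A.

Lemma hle_refl x : hle x x.
Proof. exact: himpxx. Qed.

Lemma hle1x x : hle 1 x -> x = 1.
Proof. by rewrite /hle himp1x. Qed.

Lemma hle_trans y x z : hle x y -> hle y z -> hle x z.
Proof.
move=> xy yz; have <- : (y ⇒ x) ⊙ y = x by rewrite -himp_div xy hmul1x.
by rewrite /hle himp_mul yz himpx1.
Qed.

(** Residuation: both sides say that [x ⊙ y] lies below [z]. *)
Lemma hle_galois x y z : hle x (y ⇒ z) <-> hle y (x ⇝ z).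
Proof. by rewrite {1}/hle -himp_mul hleEsimp -hsimp_mul -hleEsimp. Qed.

Lemma hmul_lel x y : hle (x ⊙ y) x.
Proof. by apply/hleEsimp; rewrite hsimp_mul hsimpxx hsimpx1. Qed.

Lemma hle_hvee1l x y : hle x (hvee1 x y).
Proof. exact/hle_galois/hle_refl. Qed.

Lemma hsimp_ler x y : hle y (x ⇝ y).
Proof. by apply/hle_galois; rewrite himpxx; apply: himpx1. Qed.

Lemma himp_antil z x y : hle x y -> hle (y ⇒ z) (x ⇒ z).
Proof. by move=> xy; apply/hle_galois; apply: hle_trans xy (hle_hvee1l y z). Qed.

Lemma hvee1_le x y : hle x y -> hvee1 x y = y.
Proof. by rewrite /hvee1 => ->; rewrite hsimp1x. Qed.

Lemma hle_hvee1r x y : hle y (hvee1 x y).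
Proof. exact: hsimp_ler. Qed.

Lemma himp_hvee1 x y : hvee1 x y ⇒ y = (x ⇒ y).
Proof.
apply: hle_anti; first exact/himp_antil/hle_hvee1l.
exact/hle_galois/hle_refl.
Qed.
End Residuation.

Lemma hsimp_antil (A : pseudoHoopType) (z x y : A) :
  hle x y -> hle (y ⇝ z) (x ⇝ z).
Proof. by move=> /hleEsimp xy; apply/hleEsimp/(@himp_antil (opposite A)). Qed.

(** For [x] below [y], (IS2) applied to [x = y ⊙ (y ⇝ x)] writes [mu x] as a product with left
    factor [mu y]. *)
Lemma IS2_mono (A : pseudoHoopType) (mu : A -> A) :
  IS2 mu -> {homo mu : x y / hle x y}.
Proof.
move=> mu2 x y xy; have <- : y ⊙ (y ⇝ x) = x.
  by rewrite -himp_hsimp_div xy hmul1x.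
by rewrite (mu2 _ _).1; apply: hmul_lel.
Qed.

Lemma mono_opposite (A : pseudoHoopType) (mu : A -> A) :
  {homo mu : x y / hle x y} ->
  {homo (mu : opposite A -> opposite A) : x y / hle x y}.
Proof. by move=> mono x y /(@hleEsimp A) xy; apply/hleEsimp/mono. Qed.

Section ImplicationHalves.
Context {A : pseudoHoopType} (mu : A -> A).

(** Since [hvee1 x (hvee1 x y) = hvee1 x y], (IS1') expands both sides to
    [mu (hvee1 x y) ⇒ mu x]. *)
Lemma mu_hvee1_himp (mu1' : forall x y, mu (x ⇒ y) = (mu (hvee1 y x) ⇒ mu y)) x y :
  mu (hvee1 x y ⇒ x) = mu (y ⇒ x).
Proof.
by rewrite mu1' (hvee1_le (hle_hvee1l x y)) -mu1'.
Qed.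

Lemma IS1'_IS1_himp (mu1' : forall x y, mu (x ⇒ y) = (mu (hvee1 y x) ⇒ mu y)) x y :
  mu (x ⇒ y) = (mu (hvee1 x y) ⇒ mu y).
Proof. by rewrite -(himp_hvee1 x y) mu1' (hvee1_le (hle_hvee1r x y)). Qed.

Hypothesis mono : {homo mu : x y / hle x y}.
Hypothesis mu1 : forall x y, mu (x ⇒ y) = (mu (hvee1 x y) ⇒ mu y).

Lemma Ker_himp_le x y : Ker mu (x ⇒ y) -> hle (mu x) (mu y).
Proof.
by rewrite /Ker /= mu1; apply/hle_trans/mono/hle_hvee1l.
Qed.

Lemma mu_one : mu 1 = 1.
Proof. by rewrite -(himpxx (1 : A)) mu1 /hvee1 himpxx hsimp1x himpxx. Qed.

Hypothesis fant : forall x y, Ker mu (y ⇒ x) -> Ker mu (hvee1 x y ⇒ x).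

Lemma mu_hvee1_le x y : hle (mu (hvee1 x y)) (mu (hvee1 y x)).
Proof.
(* Fantasticity at [y ≤ hvee1 y x] puts [hvee1 (hvee1 y x) y ⇒ hvee1 y x] in the kernel. *)
have /fant kerc : Ker mu (y ⇒ hvee1 y x) by rewrite (hle_hvee1l y x) /Ker /= mu_one.
apply: Ker_himp_le; apply: hle1x; rewrite -{1}kerc; apply/mono/himp_antil.
(* [hvee1] is monotone in its first argument, and [x ≤ hvee1 y x]. *)
exact/hsimp_antil/himp_antil/hle_hvee1r.
Qed.

Lemma IS1_IS1'_himp x y : mu (x ⇒ y) = (mu (hvee1 y x) ⇒ mu y).
Proof. by rewrite mu1 (hle_anti (mu_hvee1_le x y) (mu_hvee1_le y x)). Qed.
End ImplicationHalves.

Theorem theorem5p17 (A : pseudoHoopType) (mu : A -> A) :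
  (state_operator_II mu /\ compatible mu) <->
  ((state_operator_I mu /\ compatible mu) /\ fantastic_filter (Ker mu)).
Proof.
split=> [[[mu1' mu2 mu3 mu4] comp]|[[[mu1 mu2 mu3 mu4] comp] [_ fant1 fant2]]].
  have mu1'l x y := (mu1' x y).1.
  have mu1'r x y := (mu1' x y).2.
  split; first (split=> //; split=> // x y; split).
  - exact: IS1'_IS1_himp.
  (* Over [opposite A], [hvee1] unfolds to [hvee2] of [A]. *)
  - exact: (@IS1'_IS1_himp (opposite A)).
  split=> [|x y|x y]; first exact: comp.1.
  - by rewrite /Ker /= mu_hvee1_himp.
  - by rewrite /Ker /= (@mu_hvee1_himp (opposite A) mu mu1'r).
have mu1l x y := (mu1 x y).1.
have mu1r x y := (mu1 x y).2.
have mono := IS2_mono mu2.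
split=> //; split=> // x y; split; first exact: IS1_IS1'_himp.
exact: (@IS1_IS1'_himp (opposite A) mu (mono_opposite mono) mu1r).
Qed.
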